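(* Let $p$ be a prime and let $i\geq 0$. Then $O(c_i)=O(a_i)$, except only when $p=2$ and $i=1$ (that is, $O(c_i)=O(a_i)$ whenever $(p,i)\neq(2,1)$, and $O(c_1)\neq O(a_1)$ when $p=2$).
   Context: Fix a prime $p$ and an algebraic closure $E$ of $\mathbb{F}_p$. Put $c_{-1}=1$ and, recursively for $i\geq -1$, let $c_{i+1}\in E$ be any chosen root of $X^p-X-(c_{-1}c_0\cdots c_i)^{p-1}$. Put $a_i=(c_{-1}c_0\cdots c_i)^{p-1}$ for $i\geq -1$. All $c_i$ and $a_i$ are nonzero. For $x\in E^\times$, $O(x)$ denotes the multiplicative order of $x$. *)

(* Defs.v *)
From HB Require Import structures.
From mathcomp Require Import all_boot all_order all_algebra.
From mathcomp Require Import boolp.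

Set Implicit Arguments.
Unset Strict Implicit.
Unset Printing Implicit Defensive.

Import GRing.Theory.
Local Open Scope ring_scope.

(* The default 0 is taken exactly when x has no positive power equal to 1. *)
Definition mulorder (F : fieldType) (x : F) : nat :=
  match pselect (exists n : nat, (0 < n)%N && (x ^+ n == 1)) with
  | left ex => ex_minn ex
  | right _ => 0
  end.

(* Sequences indexed from -1 in the mathematics are shifted by one:
   c n stands for c_{n-1}, and tower_coef p c n for
   a_{n-1} = (c_{-1} c_0 ... c_{n-1})^(p-1). *)
Definition tower_coef (F : fieldType) (p : nat) (c : nat -> F) (n : nat) : F :=
  (\prod_(k < n.+1) c k) ^+ p.-1.

Definition is_tower (F : fieldType) (p : nat) (c : nat -> F) : Prop :=
  c 0 = 1 /\
  forall n : nat, root ('X^p - 'X - (tower_coef p c n)%:P) (c n.+1).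

(* K is an algebraic closure of F via iota, K being algebraically closed by
   its type. *)
Definition is_alg_closure (F : fieldType) (K : closedFieldType)
    (iota : {rmorphism F -> K}) : Prop :=
  forall x : K, algebraicOver iota x.

(* Main.v *)
(** Write a_n, c_(n+1) for the shifted sequences, q = p^(p^n) and
M = 1 + q + ... + q^(p-1).  Inductively a_n lies in the field of q elements and
has trace (-1)^n over F_p, so x |-> x^q moves c_(n+1) to c_(n+1) + (-1)^n.
Norms being M-th powers, c_(n+1)^M = a_n and a_(n+1)^M = a_n^(2p-1).  Since M is
coprime to p-1, the orders of c_(n+1) and a_(n+1) = a_n c_(n+1)^(p-1) agree as soon as 2p-1
is coprime to the order of a_n.  For p odd, 2p-1 is coprime to q-1: if r is a
common prime, the order of p mod r is a power of p dividing r-1; it is not 1,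
since p = 1 mod r would give 2p-1 = 1 mod r; so p | r-1, whence r = p+1, which is
even.  For p = 2 the orders of a_0, a_1 and a_2 are 1, 3 and a divisor of 5, and
from there on they stay prime to 3. *)

Require Import Defs.
From HB Require Import structures.
From mathcomp Require Import all_boot all_order all_algebra all_field.
From mathcomp Require Import boolp zify.

Set Implicit Arguments.
Unset Strict Implicit.
Unset Printing Implicit Defensive.

Import GRing.Theory.
Local Open Scope ring_scope.

(** * Multiplicative orders through divisibility of exponents *)

Lemma dvdn_mulorder (F : fieldType) (x : F) (m : nat) :
  (mulorder x %| m)%N = (x ^+ m == 1).
Proof.
rewrite /mulorder; case: pselect => [ex|nex]; last first.
  (* The default order 0 is consistent: 0 divides only [m = 0]. *)
  rewrite dvd0n; case: m => [|m]; first by rewrite expr0 !eqxx.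
  by apply/esym/negbTE/negP => xm; apply: nex; exists m.+1.
case: ex_minnP => n /andP[n_gt0 /eqP xn1] n_min.
rewrite {2}(divn_eq m n) exprD mulnC exprM xn1 expr1n mul1r /dvdn.
apply/eqP/idP => [->|xr]; first by rewrite expr0.
apply/eqP; rewrite -leqn0 leqNgt; apply/negP => r_gt0.
have := n_min (m %% n)%N; rewrite r_gt0 xr => /(_ isT).
by rewrite leqNgt ltn_mod n_gt0.
Qed.

Lemma eq_mulorder (F : fieldType) (x y : F) :
  (forall m, (x ^+ m == 1) = (y ^+ m == 1)) -> mulorder x = mulorder y.
Proof.
move=> xy; apply/eqP; rewrite eqn_dvd !dvdn_mulorder xy -dvdn_mulorder dvdnn /=.
by rewrite -xy -dvdn_mulorder.
Qed.

Lemma expr_eq1_coprime (F : fieldType) (x : F) (s t m : nat) :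
  coprime s t -> x ^+ t = 1 -> x ^+ (s * m) = 1 -> x ^+ m = 1.
Proof.
move=> st /eqP; rewrite -dvdn_mulorder => xt /eqP; rewrite -dvdn_mulorder => xsm.
apply/eqP; rewrite -dvdn_mulorder.
by rewrite -(@Gauss_dvdr _ s) // (coprime_dvdl xt) // coprime_sym.
Qed.

(** * Arithmetic of 2p-1 for odd p *)

Lemma coprime_double_pred (p n : nat) :
  prime p -> odd p -> coprime (p.*2.-1) (p ^ (p ^ n)).-1.
Proof.
move=> p_prime p_odd; have p_gt1 := prime_gt1 p_prime.
have q_gt1 : (1 < p ^ (p ^ n))%N.
  by rewrite -(expn0 p) ltn_exp2l // expn_gt0 prime_gt0.
rewrite coprime_has_primes; [|lia|by case: (p ^ (p ^ n))%N q_gt1 => [|[]]].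
apply/hasPn => r; rewrite !mem_primes => /and3P[r_prime _ r_dvd2].
apply/negP => /and3P[_ _ r_dvd].
have r_gt1 := prime_gt1 r_prime.
have r_odd : odd r.
  apply: dvdn_odd r_dvd _; rewrite -subn1 oddB ?odd_double //; lia.
have r_ndvdp : ~~ (p %| r.-1)%N.
  (* In [r.-1 = k * p], k is even as r and p are odd; [r <= 2p-1] then forces k = 0, that is r =
     1. *)
  apply/negP => /dvdnP[k rk].
  have : (r <= p.*2.-1)%N by apply: dvdn_leq => //; lia.
  have : odd k = false.
    move/(congr1 odd): rk; rewrite oddM p_odd andbT => <-.
    by rewrite -subn1 oddB ?r_odd // ltnW.
  case: k rk => [|[|k]] rk //=; first by move: rk; rewrite mul0n; lia.
  by move: rk; rewrite !mulSn; have := leq0n (k * p)%N; lia.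
pose x : 'F_r := p%:R.
have rx (m : nat) : (0 < m)%N -> (r %| m.-1)%N -> m%:R = 1 :> 'F_r.
  move=> m_gt0; rewrite (dvdn_pcharf (pchar_Fp r_prime)) -subn1 natrB //.
  by rewrite subr_eq0 => /eqP.
have xq : x ^+ (p ^ n) = 1.
  by rewrite -natrX; apply: rx => //; rewrite expn_gt0; lia.
have x_neq0 : x != 0.
  apply: contra_eqN xq => /eqP->.
  by rewrite expr0n expn_eq0 eqn0Ngt prime_gt0.
have xr1 : x ^+ r.-1 = 1.
  apply: (mulfI x_neq0); rewrite -exprS prednK ?prime_gt0 // mulr1.
  by rewrite -{2}(expf_card x) card_Fp.
(* The order of p modulo r divides the coprime numbers [p ^ n] and, by Fermat, [r.-1]. *)
have x1 : x ^+ 1 = 1.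
  apply: (@expr_eq1_coprime _ _ (p ^ n) r.-1); rewrite ?muln1 //.
  by rewrite coprimeXl // prime_coprime.
have : (r %| 1)%N.
  rewrite (dvdn_pcharf (pchar_Fp r_prime)).
  have : p.*2.-1%:R = 0 :> 'F_r.
    by apply/eqP; rewrite -(dvdn_pcharf (pchar_Fp r_prime)).
  have -> : p.*2.-1 = (p + p.-1)%N by lia.
  have -> : (p + p.-1 = p + p - 1)%N by lia.
  rewrite natrB ?natrD; last lia.
  by rewrite -/x -[x]expr1 x1 addrK => ->.
by rewrite dvdn1; lia.
Qed.

(** * Products and power sums over translates by the prime field *)

Section PrimeFieldTranslates.

Variables (E : fieldType) (p : nat) (e : E).
Hypotheses (pE : p \in [pchar E]) (e_neq0 : e != 0) (e_Frob : e ^+ p = e).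

Let p_prime : prime p := pcharf_prime pE.

Let natmul_inj j k : (j < p)%N -> (k < p)%N -> e *+ j = e *+ k -> j = k.
Proof.
wlog le_jk : j k / (j <= k)%N.
  by move=> H jp kp jk; case/orP: (leq_total j k) => ?; [|symmetry]; apply: H.
move=> _ kp /eqP; rewrite eq_sym -subr_eq0 -mulrnBr // -mulr_natr mulf_eq0.
rewrite (negbTE e_neq0) /= -(dvdn_pcharf pE) => p_dvd.
have : (k - j = 0)%N; last lia.
by move: p_dvd; rewrite /dvdn modn_small => [/eqP//|]; lia.
Qed.

Let roots := [seq - (e *+ k) | k <- iota 0 p].

Let roots_uniq : uniq roots.
Proof.
rewrite map_inj_in_uniq ?iota_uniq // => j k; rewrite !mem_iota !add0n /=.
by move=> jp kp /oppr_inj; apply: natmul_inj.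
Qed.

Let FrobN (y : E) : (- y) ^+ p = - y ^+ p.
Proof. by rewrite -!(pFrobenius_autE pE) rmorphN. Qed.

Let natmul_Frob k : (e *+ k) ^+ p = e *+ k.
Proof.
by rewrite -(pFrobenius_autE pE) pFrobenius_autMn pFrobenius_autE e_Frob.
Qed.

(** The [- (e *+ k)] are the p distinct roots of X^p - X, which therefore splits over them. *)
Lemma prod_prime_translates (x : E) : \prod_(k < p) (x + e *+ k) = x ^+ p - x.
Proof.
have p_gt1 := prime_gt1 p_prime.
have size_AS : size ('X^p - 'X : {poly E}) = p.+1.
  by rewrite size_polyDl size_polyXn // size_polyN size_polyX.
have roots_AS : all (root ('X^p - 'X)) roots.
  apply/allP => _ /mapP[k _ ->]; rewrite rootE !hornerE.
  by rewrite FrobN natmul_Frob subrr.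
have size_roots : size ('X^p - 'X : {poly E}) = (size roots).+1.
  by rewrite size_AS size_map size_iota.
have := all_roots_prod_XsubC size_roots roots_AS; rewrite uniq_rootsE.
move=> /(_ roots_uniq)/(congr1 (horner^~ x)).
rewrite lead_coefDl ?size_polyXn ?size_polyN ?size_polyX // lead_coefXn scale1r.
rewrite !hornerE => ->.
rewrite big_map -[p in iota 0 p]subn0 -/(index_iota 0 p) horner_prod big_mkord.
by apply: eq_bigr => k _; rewrite !hornerE opprK.
Qed.

(** [Q] has degree below p but p roots: at [- (e *+ j)] the j-th term vanishes, the other p-1 terms
    are 1 by Fermat, and the added 1 makes p = 0. *)
Lemma sum_prime_translates (x : E) : \sum_(k < p) (x + e *+ k) ^+ p.-1 = -1.
Proof.
have p_gt1 := prime_gt1 p_prime.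
pose Q : {poly E} := \sum_(k < p) ('X + (e *+ k)%:P) ^+ p.-1 + 1.
suff /(congr1 (horner^~ x)) : Q = 0.
  rewrite /Q hornerD horner_sum !hornerE => /eqP; rewrite addr_eq0 => /eqP <-.
  by apply: eq_bigr => k _; rewrite !hornerE.
apply: (@roots_geq_poly_eq0 _ _ roots) => //; last first.
  rewrite size_map size_iota (leq_trans (size_polyD _ _)) // geq_max size_poly1.
  rewrite prime_gt0 // andbT; apply: (leq_trans (size_sum _ _ _)).
  apply/bigmax_leqP => k _; rewrite -[e *+ k]opprK polyCN size_exp_XsubC.
  by rewrite prednK // prime_gt0.
apply/allP => _ /mapP[j + ->]; rewrite mem_iota add0n /= => jp.
rewrite rootE /Q hornerD horner_sum hornerE (bigD1 (Ordinal jp)) //= !hornerE.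
rewrite addNr expr0n; have -> : (p.-1 == 0)%N = false by lia.
rewrite add0r (eq_bigr (fun=> 1)) => [|k kj]; last first.
  rewrite !hornerE addrC.
  have kj0 : e *+ k - e *+ j != 0.
    apply: contra kj; rewrite subr_eq0 => /eqP ekj; apply/eqP/val_inj.
    exact: natmul_inj ekj.
  apply: (mulfI kj0); rewrite -exprS prednK ?prime_gt0 // mulr1.
  by rewrite -(pFrobenius_autE pE) rmorphB /= !pFrobenius_autE !natmul_Frob.
rewrite sumr_const cardC1 card_ord -(natrD _ _ 1) addn1 prednK ?prime_gt0 //.
by rewrite (pcharf0 pE).
Qed.

End PrimeFieldTranslates.

(** * Norms and traces along the tower *)

Section Tower.

Variables (p : nat) (E : fieldType) (c : nat -> E).
Hypotheses (pE : p \in [pchar E]) (c_tower : is_tower p c).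

Let p_prime : prime p := pcharf_prime pE.
Let p_gt0 := prime_gt0 p_prime.

Local Notation a := (tower_coef p c).
Local Notation q n := (p ^ (p ^ n))%N.
Local Notation M n := (\sum_(k < p) q n ^ k)%N.

Let exprDp k (x y : E) : (x + y) ^+ (p ^ k) = x ^+ (p ^ k) + y ^+ (p ^ k).
Proof. by rewrite exprDn_pchar // pnatX pnatE ?pE. Qed.

Lemma tower_coef0 : a 0 = 1.
Proof. by rewrite /tower_coef big_ord1 (proj1 c_tower) expr1n. Qed.

Lemma tower_coefS n : a n.+1 = a n * c n.+1 ^+ p.-1.
Proof. by rewrite /tower_coef big_ord_recr exprMn. Qed.

Lemma tower_eq n : c n.+1 ^+ p = c n.+1 + a n.
Proof.
have := proj2 c_tower n; rewrite rootE !hornerE subr_eq0 subr_eq => /eqP->.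
by rewrite addrC.
Qed.

Let sgn_Frob n j : ((-1) ^+ n) ^+ (p ^ j) = (-1) ^+ n :> E.
Proof.
elim: j => [|j IHj]; rewrite ?expr1 // expnS exprM exprAC IHj.
by rewrite exprAC -(pFrobenius_autE pE) rmorphN1.
Qed.

(** Iterates [tower_eq]; at j = p^n the sum is the trace of a_n. *)
Lemma tower_exp_trace n j :
  c n.+1 ^+ (p ^ j) = c n.+1 + \sum_(k < j) a n ^+ (p ^ k).
Proof.
elim: j => [|j IHj]; first by rewrite big_ord0 addr0 expr1.
by rewrite big_ord_recr /= addrA -IHj expnS exprM tower_eq exprDp.
Qed.

Section Step.

Variable n : nat.
Hypothesis a_q : a n ^+ q n = a n.
Hypothesis trace_a : \sum_(k < p ^ n) a n ^+ (p ^ k) = (-1) ^+ n.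

Lemma tower_exp_q k : c n.+1 ^+ (q n ^ k) = c n.+1 + (-1) ^+ n *+ k.
Proof.
elim: k => [|k IHk]; first by rewrite addr0 expr1.
rewrite expnSr exprM IHk exprDp tower_exp_trace trace_a mulrS -addrA.
(* The shift lies in the prime field, so the q-power map fixes it. *)
congr (_ + (_ + _)); rewrite -mulr_natr exprMn sgn_Frob; congr (_ * _).
elim: (p ^ n)%N => [|j IHj]; first by rewrite expr1.
by rewrite expnS exprM -(pFrobenius_autE pE) pFrobenius_aut_nat IHj.
Qed.

(** The factors [c n.+1 ^+ (q n ^ k)] are the translates of [c n.+1], whose product is c^p - c. *)
Lemma tower_norm_step : c n.+1 ^+ M n = a n.
Proof.
rewrite -prodrXr; under eq_bigr do rewrite tower_exp_q.
rewrite prod_prime_translates // ?signr_eq0 ?(sgn_Frob n 1) // tower_eq.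
by rewrite addrC addKr.
Qed.

Lemma tower_coef_exp_q k :
  a n.+1 ^+ (q n ^ k) = a n * (c n.+1 + (-1) ^+ n *+ k) ^+ p.-1.
Proof.
rewrite tower_coefS exprMn [c _ ^+ _ ^+ _]exprAC tower_exp_q; congr (_ * _).
by elim: k => [|k IHk]; rewrite ?expr1 // expnS exprM a_q.
Qed.

Lemma tower_coef_q_step : a n.+1 ^+ q n.+1 = a n.+1.
Proof.
(* [q n.+1] is [q n ^ p], and the p-th translate is the element itself. *)
rewrite expnSr (expnM p) tower_coef_exp_q -mulr_natr (pcharf0 pE) mulr0 addr0.
by rewrite tower_coefS.
Qed.

(** Transitivity of the trace: summing the conjugates of a_(n+1) over the field of q elements gives
    -a_n, whose trace is (-1)^(n+1). *)
Lemma tower_trace_step :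
  \sum_(k < p ^ n.+1) a n.+1 ^+ (p ^ k) = (-1) ^+ n.+1.
Proof.
have exprp_sum (I : finType) (F : I -> E) j :
    (\sum_i F i) ^+ (p ^ j) = \sum_i F i ^+ (p ^ j).
  apply: (big_morph (fun x => x ^+ (p ^ j)) (exprDp j)).
  by rewrite expr0n expn_eq0 eqn0Ngt p_gt0.
rewrite -(big_mkord xpredT (fun k => a n.+1 ^+ (p ^ k))) expnS big_nat_mul.
(* The exponents are cut into p blocks of length p^n, one for each conjugate. *)
have coset k : \sum_(k * p ^ n <= j < k.+1 * p ^ n) a n.+1 ^+ (p ^ j)
    = \sum_(j < p ^ n) (a n.+1 ^+ (q n ^ k)) ^+ (p ^ j).
  rewrite -{1}[(k * _)%N]add0n big_addn mulSn addnK big_mkord.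
  apply: eq_bigr => j _; rewrite -exprM; congr (_ ^+ _).
  by rewrite addnC expnD [(k * _)%N]mulnC expnM.
under eq_bigr do rewrite coset.
rewrite big_mkord exchange_big /=; under eq_bigr => j _.
  rewrite -exprp_sum; under eq_bigr do rewrite tower_coef_exp_q.
  rewrite -mulr_sumr sum_prime_translates ?signr_eq0 ?(sgn_Frob n 1) //.
  rewrite exprMn mulrC -[-1]expr1 sgn_Frob expr1.
  over.
by rewrite -mulr_sumr trace_a exprS.
Qed.

End Step.

Lemma tower_coef_Fq_trace n :
  a n ^+ q n = a n /\ \sum_(k < p ^ n) a n ^+ (p ^ k) = (-1) ^+ n.
Proof.
elim: n => [|n [a_q trace_a]].
  by rewrite tower_coef0 expr1n big_ord1 expr1n.
by split; [apply: tower_coef_q_step | apply: tower_trace_step].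
Qed.

Lemma tower_norm n : c n.+1 ^+ M n = a n.
Proof. by have [_] := tower_coef_Fq_trace n; apply: tower_norm_step. Qed.

(** The factor a_n, fixed by x^q, contributes a_n^p; the factor c^(p-1) contributes a_n^(p-1). *)
Lemma tower_coef_norm n : a n.+1 ^+ M n = a n ^+ p.*2.-1.
Proof.
have [a_q _] := tower_coef_Fq_trace n.
rewrite tower_coefS exprMn [c _ ^+ _ ^+ _]exprAC tower_norm.
have -> : a n ^+ M n = a n ^+ p.
  rewrite -prodrXr (eq_bigr (fun=> a n)) => [|k _].
    by rewrite prodr_const card_ord.
  by elim: (nat_of_ord k) => [|j IHj]; rewrite ?expr1 // expnS exprM a_q.
by rewrite -exprD; congr (_ ^+ _); lia.
Qed.

Lemma tower_coef_order n : a n ^+ (q n).-1 = 1.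
Proof.
have [a_q trace_a] := tower_coef_Fq_trace n.
(* A zero a_n would have trace 0 instead of (-1)^n. *)
have a_neq0 : a n != 0.
  apply/eqP => a0; have /eqP := signr_eq0 E n; rewrite -trace_a a0 big1 ?eqxx //.
  by move=> k _; rewrite expr0n expn_eq0 eqn0Ngt p_gt0.
by apply: (mulfI a_neq0); rewrite -exprS prednK ?expn_gt0 ?p_gt0 // mulr1.
Qed.

(** Modulo p-1, q is 1, so M is p, that is 1. *)
Lemma coprime_norm_exponent n : coprime (M n) p.-1.
Proof.
have -> : M n = (\sum_(k < p) (q n ^ k).-1 + p)%N.
  rewrite -[X in (_ + X)%N](card_ord p) -sum1_card -big_split /=.
  by apply: eq_bigr => k _; rewrite addn1 prednK // !expn_gt0 p_gt0.
have /dvdnP[d ->] : (p.-1 %| \sum_(k < p) (q n ^ k).-1)%N.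
  by apply: dvdn_sum => k _; rewrite -expnM dvdn_pred_predX.
have -> : (d * p.-1 + p = d.+1 * p.-1 + 1)%N.
  by rewrite mulSn -[X in (_ + X)%N](prednK p_gt0); lia.
by rewrite coprime_sym /coprime gcdnMDl gcdn1.
Qed.

(** The hypothesis amounts to 2p-1 being prime to the order of a_n. Either power condition then
    yields a_n^m = 1 by taking M-th powers. *)
Lemma eq_mulorder_tower n :
  (forall m, a n ^+ (p.*2.-1 * m) = 1 -> a n ^+ m = 1) ->
  mulorder (c n.+1) = mulorder (a n.+1).
Proof.
move=> a_reg; apply: eq_mulorder => m; apply/eqP/eqP => [cm|am].
  have am : a n ^+ m = 1 by rewrite -tower_norm exprAC cm expr1n.
  by rewrite tower_coefS exprMn am mul1r exprAC cm expr1n.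
have {}a_m : a n ^+ m = 1.
  by apply: a_reg; rewrite exprM -tower_coef_norm exprAC am expr1n.
have cpm : c n.+1 ^+ (m * p.-1) = 1.
  by move: am; rewrite tower_coefS exprMn a_m mul1r exprAC -exprM.
suff: (mulorder (c n.+1) %| m)%N by rewrite dvdn_mulorder => /eqP.
have dM : (mulorder (c n.+1) %| m * M n)%N.
  by rewrite dvdn_mulorder mulnC exprM tower_norm a_m.
have dp : (mulorder (c n.+1) %| m * p.-1)%N by rewrite dvdn_mulorder cpm.
have : (mulorder (c n.+1) %| gcdn (m * M n) (m * p.-1))%N.
  by rewrite dvdn_gcd dM.
by rewrite -muln_gcdr (eqP (coprime_norm_exponent n)) muln1.
Qed.

End Tower.

(** * The case p = 2 *)

Lemma tower2_coef2_expr5 (E : fieldType) (c : nat -> E) :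
  2 \in [pchar E] -> is_tower 2 c -> tower_coef 2 c 2 ^+ 5 = 1.
Proof.
move=> E2 c_tower; have := tower_coef_norm E2 c_tower 1.
(* Here M = 1 + 4 = 5, so a_2^5 = a_1^3, and a_1 lies in the field of 4 elements. *)
rewrite 2!big_ord_recl big_ord0 => ->.
exact: tower_coef_order E2 c_tower 1.
Qed.

Lemma tower2_coef_order (E : fieldType) (c : nat -> E) (n : nat) :
  2 \in [pchar E] -> is_tower 2 c ->
  exists2 t, coprime 3 t & tower_coef 2 c n.+2 ^+ t = 1.
Proof.
move=> E2 c_tower; elim: n => [|n [t t3 at1]].
  by exists 5 => //; apply: tower2_coef2_expr5.
(* The new factor 1 + q is 2 modulo 3, since q is a power of 4. *)
exists ((\sum_(k < 2) (2 ^ (2 ^ n.+2)) ^ k) * t)%N; last first.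
  by rewrite exprM (tower_coef_norm E2 c_tower) exprAC at1 expr1n.
rewrite coprimeMr t3 andbT !big_ord_recl big_ord0 addn0 expn1.
have /dvdnP[d qd] : (4.-1 %| (4 ^ (2 ^ n.+1)).-1)%N := dvdn_pred_predX _ _.
have -> : (2 ^ (2 ^ n.+2) = d * 3 + 1)%N.
  by rewrite -qd addn1 prednK ?expn_gt0 // [(2 ^ n.+2)%N]expnS (expnM 2 2).
by rewrite addnCA /coprime gcdnMDl.
Qed.

Theorem theorem4p5 (p : nat) (p_prime : prime p)
    (E : closedFieldType) (iota : {rmorphism 'F_p -> E})
    (E_closure : is_alg_closure iota)
    (c : nat -> E) (c_tower : is_tower p c) (i : nat) :
  ((p, i) <> (2, 1)%N -> mulorder (c i.+1) = mulorder (tower_coef p c i.+1)) /\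
  ((p, i) = (2, 1)%N -> mulorder (c i.+1) <> mulorder (tower_coef p c i.+1)).
Proof.
have pE : p \in [pchar E] by rewrite (fmorph_pchar iota) pchar_Fp.
split=> [pi_neq|[p2 ->]].
  apply: eq_mulorder_tower => // m; have [p2|p_odd] := even_prime p_prime.
    case: i pi_neq => [|[|i]] pi_neq; first by rewrite tower_coef0 // !expr1n.
      by case: pi_neq; rewrite p2.
    rewrite p2 in c_tower pE *.
    have [t t3 at1] := tower2_coef_order i pE c_tower.
    exact: expr_eq1_coprime at1.
  apply: expr_eq1_coprime (tower_coef_order pE c_tower i).
  exact: coprime_double_pred.
rewrite p2 in c_tower pE *; move=> c_a.
(* Equal orders would give c_2^5 = 1. But c_2^5 = a_1 = c_1, so c_1 = 1, against c_1^2 = c_1 + 1. *)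
have : (mulorder (c 2) %| 5)%N.
  by rewrite c_a dvdn_mulorder tower2_coef2_expr5.
rewrite dvdn_mulorder => /eqP c_5.
have := tower_norm pE c_tower 1.
rewrite 2!big_ord_recl big_ord0 [X in X = _]c_5 tower_coefS tower_coef0 //.
rewrite mul1r expr1 => c1; have := tower_eq c_tower 0.
rewrite -c1 expr1n tower_coef0 // => /eqP.
by rewrite -subr_eq0 opprD addNKr oppr_eq0 oner_eq0.
Qed.
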